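(* Let $G=A\ast B$ be a free product of non-trivial groups $A$ and $B$. Then a finitely generated subgroup $H$ of $G$ has finite index in $G$ if and only if $H\cap N\neq\{1\}$ for every non-trivial normal subgroup $N$ of $G$. *)

(* Defs.v *)
(* [groupType] (mathcomp.boot.monoid) does not assume finiteness; subsets of a
   group are Prop-valued [set]s, so subgroups need not be decidable. *)
From HB Require Import structures.
From mathcomp Require Import all_boot.
From mathcomp Require Import boolp classical_sets functions cardinality.

Set Implicit Arguments.
Unset Strict Implicit.
Unset Printing Implicit Defensive.

Local Open Scope classical_set_scope.
Local Open Scope group_scope.

Definition is_subgroup (G : groupType) (H : set G) : Prop :=
  [/\ H 1, forall x y, H x -> H y -> H (x * y) & forall x, H x -> H x^-1].

Definition is_normal_subgroup (G : groupType) (N : set G) : Prop :=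
  is_subgroup N /\ forall x g, N x -> N (x ^ g).

Definition generated_subgroup (G : groupType) (S : set G) : set G :=
  smallest (@is_subgroup G) S.

Definition finitely_generated (G : groupType) (H : set G) : Prop :=
  exists S : set G, finite_set S /\ H = generated_subgroup S.

Definition left_coset (G : groupType) (H : set G) (g : G) : set G :=
  [set g * h | h in H].

Definition has_finite_index (G : groupType) (H : set G) : Prop :=
  finite_set (range (left_coset H)).

Definition nontrivial_group (G : groupType) : Prop := exists x : G, x <> 1.

(* Universal property: G with the canonical homomorphisms iA and iB is the
   coproduct of A and B in the category of groups.  Injectivity of iA and iB is
   a consequence and is not assumed. *)
Definition is_free_product (A B G : groupType)
    (iA : UMagmaMorphism.type A G) (iB : UMagmaMorphism.type B G) : Prop :=
  forall (K : groupType)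
    (f : UMagmaMorphism.type A K) (g : UMagmaMorphism.type B K),
  exists h : UMagmaMorphism.type G K,
    [/\ h \o iA =1 f, h \o iB =1 g
      & forall h' : UMagmaMorphism.type G K,
          h' \o iA =1 f -> h' \o iB =1 g -> h' =1 h].

(* Main.v *)
Require Import Defs.
From HB Require Import structures.
From mathcomp Require Import all_boot.
From mathcomp Require Import boolp classical_sets functions cardinality.

Local Open Scope classical_set_scope.
Local Open Scope group_scope.

(** Write [F true] and [F false] for the images of [A] and [B] in [G].

    Finite index implies that [H] meets [N] (lemma [finite_index_meets_normal]).
    Let [n] be a nontrivial element of [N] and [d] the commutator of nontrivial
    elements of the two factors.  If [H] met [N] trivially, elements of [N] in
    one coset of [H] would be equal.  As there are finitely many cosets, two
    conjugates of [n] by different powers of [d] would coincide, so [n] would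
    commute with a power of [d], which has no conjugate in a factor.  A
    nontrivial element that commutes with such an element has infinite order
    ([commute_hyperbolic_expg_neq1]); but two different powers of [n] would
    coincide as well.

    Conversely let [H] be finitely generated of infinite index (lemma
    [infinite_index_avoids_normal]).  Consider the graph whose vertices are the
    cosets [g H], with the two factors acting by left multiplication.  The
    paths that the generators of [H] trace from the base point visit a finite
    set of vertices, the core, and the reduced word of every element of [H]
    traces a path inside the core ([finite_core]).  Let [star s] be the union of
    the orbits of the factor [F s] that meet the core.  A vertex in both stars
    belongs to the core ([star_both]).  Now let [F s] act on the set [G] by left
    multiplication over [star s] and trivially elsewhere.  This defines a new
    action of [G] on the set [G], commuting with right multiplication by [H].
    It still sends [1] to [h] for every [h] in [H], hence its kernel meets [H]
    trivially ([core_kernel_meets_trivially]).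

    It remains to find a nontrivial element of the kernel
    ([core_kernel_nontrivial]).  The letters of the two factors move only the
    two stars, whose intersection is finite, so a commutator of two letters
    acts trivially over all but finitely many vertices, and a power of it also
    preserves every coset; call such elements pure.  Since the index is
    infinite, some vertex lies on one star only; there the letters of the other
    factor act trivially, and a commutator with such a letter produces a pure
    element acting trivially over that vertex ([pure_fixing_boundary]).  By
    transitivity it has conjugates that act trivially over any given vertex
    that is not fixed.  Two nontrivial pure elements in the kernel of the
    projection of [G] to [A] times [B] have a nontrivial commutator or a common
    nontrivial power, and either acts trivially wherever one of the two elements
    does ([pure_meet]).  Finitely many steps give a nontrivial element that acts
    trivially everywhere.

    Both directions use reduced words: [normal_form_exists] obtains them from
    the universal property, and [commuting_common_power] describes commuting
    elements. *)

Set Implicit Arguments.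
Unset Strict Implicit.
Unset Printing Implicit Defensive.

(** * Actions on a set and free products *)

Record bijection (X : Type) := Bijection {
  bij_fun :> X -> X;
  bij_inv : X -> X;
  bij_funK : cancel bij_fun bij_inv;
  bij_invK : cancel bij_inv bij_fun
}.

Section BijectionGroup.
Variable X : Type.
Implicit Types f g h : bijection X.

Lemma bijectionP f g : f =1 g -> f = g.
Proof.
case: f g => [f f' fK f'K] [g g' gK g'K] /= /funext fg.
rewrite -{}fg in gK g'K *.
have e : f' = g' by apply/funext => x; rewrite -{1}[x]g'K fK.
by subst g'; congr Bijection; exact: Prop_irrelevance.
Qed.

HB.instance Definition _ := gen_eqMixin (bijection X).
HB.instance Definition _ := gen_choiceMixin (bijection X).

Definition bij_one := @Bijection X id id (fun=> erefl) (fun=> erefl).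
Definition bij_mul f g :=
  Bijection (can_comp (bij_funK f) (bij_funK g))
    (can_comp (bij_invK g) (bij_invK f)).
Definition bij_opp f := Bijection (bij_invK f) (bij_funK f).

Lemma bij_mulA : associative bij_mul.
Proof. by move=> f g h; apply: bijectionP. Qed.
Lemma bij_mul1 : left_id bij_one bij_mul.
Proof. by move=> f; apply: bijectionP. Qed.
Lemma bij_mulr1 : right_id bij_one bij_mul.
Proof. by move=> f; apply: bijectionP. Qed.
Lemma bij_mulV : left_inverse bij_one bij_opp bij_mul.
Proof. by move=> f; apply: bijectionP => x /=; rewrite bij_funK. Qed.
Lemma bij_mulrV : right_inverse bij_one bij_opp bij_mul.
Proof. by move=> f; apply: bijectionP => x /=; rewrite bij_invK. Qed.

HB.instance Definition _ :=
  isGroup.Build (bijection X) bij_mulA bij_mul1 bij_mulr1 bij_mulV bij_mulrV.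

End BijectionGroup.

Definition is_action (G : groupType) (D : set G) (X : Type)
    (act : G -> X -> X) : Prop :=
  (forall x, act 1 x = x) /\
  (forall g h, D g -> D h -> forall x, act (g * h) x = act g (act h x)).

Section ActionHom.
Variables (K : groupType) (X : Type) (act : K -> X -> X).
Hypothesis actP : is_action setT act.

Lemma action_invl g : cancel (act g) (act g^-1).
Proof. by case: actP => a1 aM x; rewrite -aM // mulVg a1. Qed.

Lemma action_invr g : cancel (act g^-1) (act g).
Proof. by case: actP => a1 aM x; rewrite -aM // mulgV a1. Qed.

Definition action_bij g := Bijection (@action_invl g) (@action_invr g).

Lemma action_bij_monoid_morphism :
  action_bij 1 = 1 /\ {morph action_bij : g h / g * h}.
Proof.
case: actP => a1 aM; split=> [|g h]; apply: bijectionP => x /=.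
  exact: a1.
exact: aM.
Qed.

HB.instance Definition _ :=
  isUMagmaMorphism.Build K (bijection X) action_bij action_bij_monoid_morphism.

Definition action_hom : UMagmaMorphism.type K (bijection X) := action_bij.

End ActionHom.

(** The universal property seen from inside [G], with generation by the factors
    as an induction principle and existence of homomorphisms tested on actions.
    Indexing the two factors by [bool] makes every later argument symmetric in
    them: [~~ s] is the other factor. *)
Record internal_free_product (G : groupType) (F : bool -> set G) : Prop := {
  factor_subgroup : forall s, is_subgroup (F s);
  factor_ind : forall P : G -> Prop, P 1 ->
    (forall s x g, F s x -> P g -> P (x * g)) -> forall g, P g;
  factor_act : forall (X : Type) (act : bool -> G -> X -> X),
    (forall s, is_action (F s) (act s)) ->
    exists phi : G -> X -> X,
      is_action setT phi /\ forall s x, F s x -> phi x = act s x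
}.

Section Internalize.
Variables (A B G : groupType).
Variables (iA : UMagmaMorphism.type A G) (iB : UMagmaMorphism.type B G).
Hypothesis hG : is_free_product iA iB.

Definition factors (s : bool) : set G := if s then range iA else range iB.

Lemma range_subgroup (K : groupType) (f : UMagmaMorphism.type K G) :
  is_subgroup (range f).
Proof.
split; first by exists 1 => //; rewrite gmulf1.
  by move=> _ _ [a _ <-] [b _ <-]; exists (a * b) => //; rewrite gmulfM.
by move=> _ [a _ <-]; exists a^-1 => //; rewrite gmulfV.
Qed.

Lemma factors_subgroup s : is_subgroup (factors s).
Proof. by case: s; apply: range_subgroup. Qed.

Lemma pullback_action (K : groupType) (f : UMagmaMorphism.type K G) X act :
  is_action (range f) act -> is_action setT (fun a (x : X) => act (f a) x).
Proof.
move=> [a1 aM]; split=> [x|a b _ _ x]; first by rewrite gmulf1 a1.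
by rewrite gmulfM aM.
Qed.

Lemma free_product_act X (act : bool -> G -> X -> X) :
  (forall s, is_action (factors s) (act s)) ->
  exists phi : G -> X -> X,
    is_action setT phi /\ forall s x, factors s x -> phi x = act s x.
Proof.
move=> actP.
have [h [hA hB _]] := hG (action_hom (pullback_action (actP true)))
  (action_hom (pullback_action (actP false))).
exists (fun g => bij_fun (h g)); split.
  by split=> [x|g k _ _ x]; rewrite ?gmulf1 ?gmulfM.
by case=> _ [a _ <-]; [have /= -> := hA a | have /= -> := hB a].
Qed.

Lemma free_product_act_unique X (phi psi : G -> X -> X) :
  is_action setT phi -> is_action setT psi ->
  (forall s x, factors s x -> phi x = psi x) -> phi = psi.
Proof.
move=> phiP psiP agree.
have [k [_ _ uniq]] := hG (action_hom phiP \o iA) (action_hom phiP \o iB).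
have e1 : action_hom phiP =1 k :> (G -> bijection X) by apply: uniq.
have e2 : action_hom psiP =1 k :> (G -> bijection X).
  apply: uniq => a; apply: bijectionP => x /=.
    by rewrite (agree true) //; exists a.
  by rewrite (agree false) //; exists a.
apply/funext => g; apply/funext => x.
by have := congr1 (fun f : bijection X => f x) (etrans (e1 g) (esym (e2 g))).
Qed.

(** Twisting the regular action of [G] on [G * bool] by the flip of the second
    coordinate over a subgroup [K] does not change how [K] acts; if [K]
    contains both factors, uniqueness says that it does not change the action
    of [G] either, which puts every [g] in [K]. *)
Lemma factors_generate (K : set G) :
  is_subgroup K -> (forall s, factors s `<=` K) -> forall g, K g.
Proof.
move=> [K1 KM KV] FK g.
have KMl a b : K a -> K (a * b) = K b.
  move=> Ka; apply/propext; split; last exact: KM.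
  by move=> Kab; rewrite -[b](mulKg a); apply: KM => //; apply: KV.
pose flip (x : G * bool) := (x.1, `[< K x.1 >] (+) x.2).
have flipK : involutive flip by move=> [a b]; rewrite /flip /= addKb.
pose phi (a : G) (x : G * bool) := (a * x.1, x.2).
have phiP : is_action setT phi.
  by split=> [[a b]|a b _ _ x]; rewrite /phi ?mul1g //= mulgA.
have psiP : is_action setT (fun a => flip \o phi a \o flip).
  case: phiP => p1 pM; split=> [x|a b _ _ x] /=; first by rewrite p1 flipK.
  by rewrite flipK pM.
have agree s x : factors s x -> phi x = flip \o phi x \o flip.
  move=> /FK Kx; apply/funext => -[a b] /=.
  by rewrite /phi /flip /= KMl // addKb.
have /(congr1 (fun f => f g (1, false))) := free_product_act_unique phiP psiP agree.
rewrite /phi /flip /= (asboolT K1) mulg1 => -[/esym].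
by rewrite addbC /= => /negbFE/asboolP.
Qed.

Lemma free_product_internal : internal_free_product factors.
Proof.
split; [exact: factors_subgroup| |exact: free_product_act].
move=> P P1 PM g.
(* The elements that preserve [P] under left multiplication, together with
   their inverses, form a subgroup. *)
pose K : set G := [set x | (forall h, P h -> P (x * h)) /\
                          (forall h, P h -> P (x^-1 * h))].
suff : K g by case=> Kg _; rewrite -[g]mulg1; apply: Kg.
apply: factors_generate => [|s x Fx].
  split; first by split=> h; rewrite ?invg1 mul1g.
    move=> x y [Kx Kx'] [Ky Ky']; split=> h Ph; first by rewrite -mulgA; apply/Kx/Ky.
    by rewrite invgM -mulgA; apply/Ky'/Kx'.
  by move=> x [Kx Kx']; split=> // h Ph; rewrite invgK; apply: Kx.
have [_ _ FV] := factors_subgroup s.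
by split=> h; apply: (PM s) => //; apply: FV.
Qed.

(** The homomorphism from [G] that is the identity on one factor and trivial
    on the other shows that the factor embeds. *)
Lemma factor_nontrivial s : nontrivial_group A -> nontrivial_group B ->
  exists2 x, factors s x & x <> 1.
Proof.
move=> [a a1] [b b1]; case: s.
  have [h [hA _ _]] := hG (@idfun A) (@one_fun B A).
  exists (iA a); first by exists a.
  by move=> ia; apply: a1; have /= <- := hA a; rewrite ia gmulf1.
have [h [_ hB _]] := hG (@one_fun A B) (@idfun B).
exists (iB b); first by exists b.
by move=> ib; apply: b1; have /= <- := hB b; rewrite ib gmulf1.
Qed.

End Internalize.

(** * Reduced words *)

Section FreeProduct.
Variables (G : groupType) (F : bool -> set G).
Hypothesis HF : internal_free_product F.
Implicit Types (s : bool) (g h x y : G) (u v w : seq G).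

Let F1 s : F s 1. Proof. by case: (factor_subgroup HF s). Qed.
Let FM s x y : F s x -> F s y -> F s (x * y).
Proof. by case: (factor_subgroup HF s) => _ + _; apply. Qed.
Let FV s x : F s x -> F s x^-1.
Proof. by case: (factor_subgroup HF s) => _ _; apply. Qed.

(** The action of [G] on itself through its projection to the factor [s]. *)
Lemma factor_projection_act s :
  exists phi : G -> G -> G, is_action setT phi /\
    forall t x, F t x -> phi x = if t == s then *%g x else id.
Proof.
apply: (factor_act HF (act := fun t x => if t == s then *%g x else id)).
move=> t; case: eqP => _; split=> // [x|x y _ _ z]; first exact: mul1g.
by rewrite mulgA.
Qed.

Lemma factors_disjoint s x : F s x -> F (~~ s) x -> x = 1.
Proof.
move=> Fx Fx'; have [phi [_ phiF]] := factor_projection_act s.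
have := phiF _ _ Fx; rewrite (phiF _ _ Fx') eqxx; case: s {Fx Fx' phiF} => /=.
  by move=> /(congr1 (fun f => f 1)); rewrite mulg1.
by move=> /(congr1 (fun f => f 1)); rewrite mulg1.
Qed.

(** Words are sequences of elements of [G] itself.  The side of a letter is the
    factor that contains it; it is only meaningful for letters. *)
Definition side x : bool := `[< F true x >].
Definition letter x : bool := (x != 1) && `[< exists s, F s x >].
Definition alternates : rel G := fun x y => side x != side y.
Definition reduced w : bool := all letter w && sorted alternates w.
Definition prodw w : G := \prod_(x <- w) x.
Definition winv w := rev [seq x^-1 | x <- w].
Definition starts_off s w : bool := if w is x :: _ then side x != s else true.

Lemma side_letter s x : F s x -> x != 1 -> side x = s.
Proof.
move=> Fx /eqP x1; rewrite /side; case: s Fx => Fx; first exact/asboolP.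
by apply/asboolPn => Fx'; apply: x1; exact: (factors_disjoint Fx Fx').
Qed.

Lemma letterP s x : F s x -> x != 1 -> letter x.
Proof. by move=> Fx x1; rewrite /letter x1; apply/asboolP; exists s. Qed.

Lemma letter_neq1 x : letter x -> x != 1. Proof. by case/andP. Qed.

Lemma letter_side x : letter x -> F (side x) x.
Proof. by case/andP => x1 /asboolP[s Fx]; rewrite (side_letter Fx). Qed.

Lemma letterV x : letter x -> letter x^-1.
Proof.
move=> lx; apply: (letterP (s := side x)); first exact/FV/letter_side.
by rewrite invg_eq1 letter_neq1.
Qed.

Lemma sideV x : side x^-1 = side x.
Proof. by apply/asbool_equiv_eq; split=> /FV //; rewrite invgK. Qed.

Lemma prodw_nil : prodw [::] = 1. Proof. exact: big_nil. Qed.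
Lemma prodw_cons x w : prodw (x :: w) = x * prodw w. Proof. exact: big_cons. Qed.
Lemma prodw1 x : prodw [:: x] = x.
Proof. by rewrite prodw_cons prodw_nil mulg1. Qed.
Lemma prodw_cat u v : prodw (u ++ v) = prodw u * prodw v.
Proof. exact: big_cat. Qed.

Lemma prodw_winv w : prodw (winv w) = (prodw w)^-1.
Proof.
elim: w => [|x w IH]; first by rewrite prodw_nil invg1.
by rewrite /winv /= rev_cons -cats1 prodw_cat IH prodw1 prodw_cons invgM.
Qed.

Lemma winvK : involutive winv.
Proof.
move=> w; rewrite /winv map_rev revK -map_comp map_id_in // => x _.
exact: invgK.
Qed.

Lemma winv_cat u v : winv (u ++ v) = winv v ++ winv u.
Proof. by rewrite /winv map_cat rev_cat. Qed.

Lemma all_letter_winv w : all letter w -> all letter (winv w).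
Proof. by rewrite all_rev all_map => /sub_all; apply=> x /= /letterV. Qed.

Lemma reduced_cons x w :
  reduced (x :: w) = [&& letter x, starts_off (side x) w & reduced w].
Proof.
rewrite /reduced /=; case: w => [|y w] /=; first by rewrite !andbT.
rewrite /alternates [side y == _]eq_sym -!andbA.
by do !bool_congr.
Qed.

Lemma reduced_letters w : reduced w -> all letter w. Proof. by case/andP. Qed.

Lemma reduced_catr u v : reduced (u ++ v) -> reduced v.
Proof. by elim: u => //= x u IH; rewrite reduced_cons => /and3P[_ _ /IH]. Qed.

Lemma reduced_winv w : reduced w -> reduced (winv w).
Proof.
case/andP=> /all_letter_winv lw sw; rewrite /reduced lw /winv rev_sorted.
rewrite sorted_map (eq_sorted (e' := alternates)) // => x y /=.
by rewrite /alternates !sideV eq_sym.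
Qed.

Lemma reduced_cat u x v :
  reduced (rcons u x) -> reduced v -> starts_off (side x) v ->
  reduced (rcons u x ++ v).
Proof.
move=> /andP[lu su] /andP[lv sv] off; rewrite /reduced all_cat lu lv /=.
case: u su {lu} => [|y u] /=.
  by case: v off sv {lv} => //= y v off ->; rewrite /alternates eq_sym off.
rewrite cat_path => ->; rewrite last_rcons.
by case: v off sv {lv} => //= z v off ->; rewrite /alternates eq_sym off.
Qed.

(** Multiplication by an element of the factor [s] only affects the first
    letter, and only when that letter lies in the same factor: [hd s w] is that
    letter, or [1] when the word starts in the other factor. *)
Definition hd s w : G :=
  if w is x :: _ then if side x == s then x else 1 else 1.
Definition tl s w : seq G :=
  if w is x :: w' then if side x == s then w' else w else [::].
Definition glue x w := if x == 1 then w else x :: w.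
Definition push s x w :=
  if reduced w then glue (x * hd s w) (tl s w) else w.

Lemma prodw_glue x w : prodw (glue x w) = x * prodw w.
Proof. by rewrite /glue; case: eqP => [->|_]; rewrite ?mul1g ?prodw_cons. Qed.

Lemma hd_factor s w : reduced w -> F s (hd s w).
Proof.
case: w => [|x w] //=; rewrite reduced_cons => /and3P[/letter_side + _ _].
by case: eqP => [->|].
Qed.

Lemma reduced_tl s w : reduced w -> reduced (tl s w).
Proof.
by case: w => //= x w; case: ifP => // _; rewrite reduced_cons => /and3P[].
Qed.

Lemma tl_off s w : reduced w -> starts_off s (tl s w).
Proof.
case: w => //= x w; rewrite reduced_cons => /and3P[_ + _].
by case: eqP => [->|/eqP].
Qed.

Lemma glue_hd_tl s w : reduced w -> glue (hd s w) (tl s w) = w.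
Proof.
case: w => [|x w]; first by rewrite /glue eqxx.
rewrite reduced_cons => /and3P[/letter_neq1 x1 _ _] /=; rewrite /glue.
by case: (side x == s); rewrite ?eqxx // (negPf x1).
Qed.

Lemma glueP s x w : F s x -> reduced w -> starts_off s w ->
  [/\ reduced (glue x w), hd s (glue x w) = x & tl s (glue x w) = w].
Proof.
move=> Fx rw off; rewrite /glue; case: eqP => [->|/eqP x1].
  by split=> //; case: w off {rw} => //= y w /negPf ->.
have sx := side_letter Fx x1.
by split; rewrite /= ?sx ?eqxx // reduced_cons (letterP Fx x1) sx off.
Qed.

Lemma reduced_push s x w : F s x -> reduced w -> reduced (push s x w).
Proof.
move=> Fx rw; rewrite /push rw; have := reduced_tl s rw; have := tl_off s rw.
by move=> off rt; have [] := glueP (FM Fx (hd_factor s rw)) rt off.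
Qed.

Lemma prodw_push s x w : reduced w -> prodw (push s x w) = x * prodw w.
Proof.
by move=> rw; rewrite /push rw prodw_glue -mulgA -(prodw_glue (hd s w)) glue_hd_tl.
Qed.

Lemma push_action s : is_action (F s) (push s).
Proof.
split=> [w|x y Fx Fy w].
  by rewrite /push; case: ifP => // rw; rewrite mul1g glue_hd_tl.
have [rw|/negPf nrw] := boolP (reduced w); last by rewrite /push !nrw.
rewrite {2}/push reduced_push //.
rewrite [push s y w]/push [push s _ w]/push rw.
have [_ -> ->] := glueP (FM Fy (hd_factor s rw)) (reduced_tl s rw) (tl_off s rw).
by rewrite mulgA.
Qed.

(** The action of the free product on words that extends the actions [push] of
    the factors takes the empty word to the normal form. *)
Lemma normal_form_exists : exists nf : G -> seq G,
  (forall g, reduced (nf g) /\ prodw (nf g) = g) /\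
  (forall w, reduced w -> nf (prodw w) = w).
Proof.
have [phi [[phi1 phiM] phiF]] := factor_act HF push_action.
exists (fun g => phi g [::]); split.
  apply: (factor_ind HF) => [|s x g Fx [rg pg]]; first by rewrite phi1 prodw_nil.
  rewrite phiM // (phiF _ _ Fx); split; first exact: reduced_push.
  by rewrite prodw_push // pg.
elim=> [|x w IH]; first by rewrite prodw_nil phi1.
rewrite reduced_cons => /and3P[lx off rw].
rewrite prodw_cons phiM // IH // (phiF _ _ (letter_side lx)) /push rw.
case: w off {IH rw} => [|y w] /=; first by rewrite mulg1 /glue (negPf (letter_neq1 lx)).
by move=> /negPf ->; rewrite mulg1 /glue (negPf (letter_neq1 lx)).
Qed.

Definition nf : G -> seq G := sval (cid normal_form_exists).

Lemma reduced_nf g : reduced (nf g).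
Proof. by rewrite /nf; case: cid => f /= [fP _]; case: (fP g). Qed.

Lemma nfK : cancel nf prodw.
Proof. by move=> g; rewrite /nf; case: cid => f /= [fP _]; case: (fP g). Qed.

Lemma prodwK w : reduced w -> nf (prodw w) = w.
Proof. by rewrite /nf; case: cid => f /= [_]; apply. Qed.

Lemma prodw_inj u v : reduced u -> reduced v -> prodw u = prodw v -> u = v.
Proof. by move=> ru rv e; rewrite -(prodwK ru) e prodwK. Qed.

Lemma push_cat s x u v : u != [::] -> reduced (u ++ v) ->
  exists2 u', push s x (u ++ v) = u' ++ v & size u <= (size u').+1.
Proof.
case: u => // y u _ ruv; rewrite /push ruv /= /glue.
by case: ifP => _; case: ifP => _;
  [exists u|exists (y :: u)|exists (x * y :: u)|exists [:: x * 1, y & u]] => //=;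
  do 2?apply: leqW.
Qed.

(** Each letter on the left cancels at most one letter, so a long word keeps
    its tail. *)
Lemma absorb r u v :
  all letter r -> reduced (u ++ v) -> size r <= size u ->
  exists u', reduced (u' ++ v) /\ prodw (u' ++ v) = prodw r * prodw (u ++ v).
Proof.
move=> lr ruv ru.
suff [u' [ru' eu' _]] : exists u', [/\ reduced (u' ++ v),
    prodw (u' ++ v) = prodw r * prodw (u ++ v) & size u <= size u' + size r].
  by exists u'.
elim: r lr ru => [|x r IH] /=; first by exists u; rewrite prodw_nil mul1g addn0.
move=> /andP[lx /IH {}IH] ru; have [u1 [ru1 eu1 su1]] := IH (ltnW ru).
have u1n : u1 != [::].
  by apply: contraTneq su1 => ->; rewrite add0n -ltnNge.
have [u' eu' su'] := push_cat (side x) x u1n ru1.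
exists u'; rewrite -eu'; split; first exact: reduced_push (letter_side lx) ru1.
  by rewrite prodw_push // eu1 prodw_cons mulgA.
by rewrite addnS -addSn (leq_trans su1) // leq_add2r.
Qed.


(** * Commuting elements *)

Definition wpow w n := flatten (nseq n w).

Lemma wpowS w n : wpow w n.+1 = w ++ wpow w n. Proof. by []. Qed.

Lemma size_wpow w n : size (wpow w n) = (n * size w)%N.
Proof. by elim: n => //= n IH; rewrite wpowS size_cat IH mulSn. Qed.

Lemma prodw_wpow w n : prodw (wpow w n) = prodw w ^+ n.
Proof.
elim: n => [|n IH]; first by rewrite prodw_nil.
by rewrite wpowS prodw_cat IH expgS.
Qed.

Lemma wpow_cat_commute u v n : u ++ v = v ++ u -> wpow u n ++ v = v ++ wpow u n.
Proof.
move=> e; elim: n => [|n IH]; first by rewrite cats0.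
by rewrite wpowS -catA IH !catA e.
Qed.

(** Both sides have the same length, and they commute, hence they are equal. *)
Lemma commuting_words u v :
  u ++ v = v ++ u -> wpow u (size v) = wpow v (size u).
Proof.
move=> e.
have e' := wpow_cat_commute (size u) (esym (wpow_cat_commute (size v) e)).
have := congr1 (fun w => w == wpow u (size v) ++ wpow v (size u)) (esym e').
rewrite eqxx eqseq_cat; last by rewrite !size_wpow mulnC.
by case/esym/andP => /eqP.
Qed.

Definition cyclically_reduced w := all letter w && cycle alternates w.

Lemma cyclically_reducedP w : cyclically_reduced w -> reduced w.
Proof.
case: w => [|x w] // /andP[lw]; rewrite /= rcons_path => /andP[pw _].
by rewrite /reduced lw.
Qed.

Lemma cyclically_reduced_winv w :
  cyclically_reduced w -> cyclically_reduced (winv w).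
Proof.
case/andP=> /all_letter_winv lw cw; rewrite /cyclically_reduced lw /winv rev_cycle.
move: cw; case: w {lw} => //= x w; rewrite -map_rcons path_map /=.
by rewrite (eq_path (e' := alternates)) // => y z; rewrite /= /alternates !sideV eq_sym.
Qed.

Lemma cyclically_reduced_cat u w v : cyclically_reduced w -> w != [::] ->
  reduced (u ++ w) -> reduced (w ++ v) -> reduced (u ++ w ++ w ++ v).
Proof.
case: w => [|x w] // /andP[_]; rewrite [cycle _ _]/= rcons_path => /andP[_ alt] _ ruw rwv.
move: ruw rwv; rewrite lastI => ruw rwv.
rewrite catA -rcons_cat; apply: reduced_cat => //; first by rewrite rcons_cat.
by rewrite -lastI /= eq_sym.
Qed.

Lemma reduced_wpow w n : cyclically_reduced w -> reduced (wpow w n).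
Proof.
move=> cw; have [->|w0] := eqVneq w [::]; first by elim: n.
elim: n => // -[_|n IH]; first by rewrite wpowS cats0 cyclically_reducedP.
rewrite !wpowS; apply: (cyclically_reduced_cat (u := [::])) => //.
exact: cyclically_reducedP.
Qed.

Lemma expg_cyclically_reduced_inj w m n : cyclically_reduced w -> w != [::] ->
  prodw w ^+ m = prodw w ^+ n -> m = n.
Proof.
move=> cw w0; rewrite -!prodw_wpow => /prodw_inj - /(_ _ _)/(congr1 size).
rewrite !size_wpow => /(_ _ _)/eqP; rewrite eqn_pmul2r ?size_eq0 ?lt0n ?size_eq0 // => e.
by apply/eqP/e; exact: reduced_wpow.
Qed.

(** Multiplying an element that commutes with [prodw w] by a large power of
    [prodw w] absorbs all cancellation: the normal form of the product begins
    and ends with [w], so that it can be concatenated with [w] on both sides. *)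
Lemma commute_absorb w g : cyclically_reduced w -> commute (prodw w) g ->
  exists n z, [/\ reduced (z ++ w), reduced (w ++ z), z ++ w = w ++ z
                & prodw z = g * prodw w ^+ n].
Proof.
move=> cw cg; case: (posnP (size w)) => [/size0nil ->|w0].
  exists 0, (nf g); rewrite cats0 nfK mulg1 cat0s; split=> //; exact: reduced_nf.
pose k := size (nf g); exists k.+1.
have sizek v : size v = size w -> k <= size (wpow v k).
  by move=> e; rewrite size_wpow e leq_pmulr.
have tail v h : cyclically_reduced v -> size v = size w -> all letter (nf h) ->
    size (nf h) = k -> exists u, reduced (u ++ v) /\ prodw (u ++ v) = h * prodw v ^+ k.+1.
  move=> cv sv lh sh.
  have [|| u [ru eu]] := @absorb (nf h) (wpow v k) v lh.
  - by rewrite (wpow_cat_commute k erefl); exact: (reduced_wpow k.+1 cv).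
  - by rewrite sh sizek.
  exists u; split=> //; rewrite eu nfK prodw_cat prodw_wpow -expgSr //.
have [u [ru eu]] := tail w g cw erefl (reduced_letters (reduced_nf g)) erefl.
have [||||u' [ru' eu']] := tail (winv w) g^-1.
- exact: cyclically_reduced_winv.
- by rewrite size_rev size_map.
- exact/reduced_letters/reduced_nf.
- rewrite -{1}[g]nfK -prodw_winv prodwK ?size_rev ?size_map //.
  exact/reduced_winv/reduced_nf.
(* The mirror image, applied to the inverse, fixes the beginning. *)
have e : u ++ w = w ++ winv u'.
  apply: prodw_inj => //.
    by rewrite -[w in w ++ _]winvK -winv_cat; apply: reduced_winv.
  rewrite eu -[w in w ++ _]winvK -winv_cat prodw_winv eu' prodw_winv expVgn.
  by rewrite invgM !invgK; apply: commuteX; exact: commute_sym.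
have rw1 : reduced ((u ++ w) ++ w).
  rewrite -catA -[w in w ++ w]cats0 -catA.
  apply: cyclically_reduced_cat; rewrite -?size_eq0 -?lt0n ?cats0 //.
  exact: cyclically_reducedP.
have rw2 : reduced (w ++ u ++ w).
  rewrite e; apply: (cyclically_reduced_cat (u := [::])) => //.
  - by rewrite -size_eq0 -lt0n.
  - exact: cyclically_reducedP.
  - by rewrite -e.
exists (u ++ w); split=> //.
apply: prodw_inj => //; rewrite [LHS]prodw_cat [RHS]prodw_cat eu.
by rewrite -mulgA -expgSr expgS mulgA -cg -mulgA.
Qed.

Definition elliptic g := exists s h, F s (g ^ h).

Lemma cyclic_reduction g : ~ elliptic g ->
  exists h w, [/\ cyclically_reduced w, w != [::] & prodw w = g ^ h].
Proof.
move=> ng.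
suff H n w h : size w <= n -> reduced w -> prodw w = g ^ h ->
  exists h w, [/\ cyclically_reduced w, w != [::] & prodw w = g ^ h].
  apply: (H (size (nf g)) (nf g) 1) => //; first exact: reduced_nf.
  by rewrite conjg1 nfK.
elim: n w h => [|n IH] w h.
  rewrite leqn0 size_eq0 => /eqP -> _ e; case: ng; exists true, h.
  by rewrite -e prodw_nil.
case: w => [|x w] sw rw e.
  by case: ng; exists true, h; rewrite -e prodw_nil.
case/lastP: w sw rw e => [|w y] sw rw e.
  case: ng; exists (side x), h; rewrite -e prodw1.
  by apply: letter_side; rewrite reduced_cons in rw; case/and3P: rw.
have [alt|nalt] := boolP (alternates y x).
  exists h, (x :: rcons w y); split=> //.
  move: rw => /andP[lw sw']; rewrite /cyclically_reduced lw /= rcons_path.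
  by rewrite last_rcons alt andbT.
have [lx ly] : letter x /\ letter y.
  by move: (reduced_letters rw); rewrite /= all_rcons => /and3P[].
have rxw : reduced (x :: w).
  have := reduced_winv rw; rewrite -rcons_cons -cats1 winv_cat => /reduced_catr.
  by move=> /reduced_winv; rewrite winvK.
(* Conjugation moves the last letter to the front, where it merges with [x]. *)
apply: (IH (push (side y) y (x :: w)) (h * y^-1)).
- rewrite -ltnS (leq_trans _ sw) // /push rxw /= size_rcons.
  have -> : side x == side y by rewrite eq_sym; apply: negbNE.
  by rewrite /glue; case: ifP => _ //=; rewrite ltnW.
- exact: reduced_push (letter_side ly) rxw.
rewrite prodw_push // conjgM -e -rcons_cons -cats1 prodw_cat prodw1.
by rewrite conjgE invgK mulgK.
Qed.

Lemma expg_hyperbolic_neq1 g n : ~ elliptic g -> 0 < n -> g ^+ n <> 1.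
Proof.
move=> /cyclic_reduction[h [w [cw w0 e]]] n0 gn.
have := @expg_cyclically_reduced_inj w n 0 cw w0.
by rewrite e -conjXg gn conj1g expg0 => /(_ erefl) n0'; rewrite n0' in n0.
Qed.

(** After conjugation [g] is given by a cyclically reduced word [w].  By
    [commute_absorb] the product of [h] and a power of [g] is given by a word [z]
    that commutes with [w] as a word; words that commute have a common power. *)
Lemma commuting_common_power g h : ~ elliptic g -> h <> 1 -> commute g h ->
  exists m n, [/\ 0 < m, h ^+ m <> 1 & h ^+ m = g ^+ n \/ h ^+ m = g ^- n].
Proof.
move=> /cyclic_reduction[k [w [cw w0 e]]] h1 cgh.
suff [m [n [m0 hm1 hm]]] : exists m n, [/\ 0 < m, (h ^ k) ^+ m <> 1
    & (h ^ k) ^+ m = prodw w ^+ n \/ (h ^ k) ^+ m = prodw w ^- n].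
  exists m, n; rewrite -conjXg in hm1; split=> //.
    by move=> e1; rewrite e1 conj1g in hm1.
  by move: hm; rewrite e -!conjXg -conjVg => -[] /conjg_inj; [left|right].
have {cgh} cwh : commute (prodw w) (h ^ k) by rewrite e /commute -!conjMg cgh.
have {h1} : h ^ k <> 1 by move/eqP; rewrite conjg_eq1 => /eqP.
move: (h ^ k) cwh => {}h cwh h1.
have [n [z [rzw rwz czw ez]]] := commute_absorb cw cwh.
have := congr1 prodw (commuting_words czw); rewrite !prodw_wpow ez => e1.
have {e1} e2 : h ^+ size w * prodw w ^+ (n * size w) = prodw w ^+ size z.
  by rewrite -e1 expgMn -?expgnA //; apply: commuteX; exact: commute_sym.
exists (size w).
have hE : h ^+ size w = prodw w ^+ (size z - n * size w) \/
          h ^+ size w = prodw w ^- (n * size w - size z).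
  case: (leqP (n * size w) (size z)) => [le|/ltnW le]; [left|right].
    by rewrite expgnFr // -e2 mulgK.
  by rewrite expgnFr // -e2 invgF mulgK.
have w_gt0 : 0 < size w by rewrite lt0n size_eq0.
have hn1 : h ^+ size w <> 1.
  move=> hm; apply: h1; rewrite hm mul1g in e2.
  (* Then [z] and a power of [w] are commuting words of the same length. *)
  have sz := expg_cyclically_reduced_inj cw w0 e2.
  have := congr1 (fun u => u == z ++ wpow w n) (wpow_cat_commute n (esym czw)).
  rewrite eqxx eqseq_cat ?size_wpow // => /andP[/eqP ewz _].
  by move: ez; rewrite -ewz prodw_wpow => /esym/(canRL (mulgK _)); rewrite mulgV.
by case: hE => hE; [exists (size z - n * size w)%N | exists (n * size w - size z)%N];
  split=> //; [left|right].
Qed.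

Lemma commute_hyperbolic_expg_neq1 g h n : ~ elliptic g -> h <> 1 ->
  commute g h -> 0 < n -> h ^+ n <> 1.
Proof.
move=> ng h1 cgh n0 hn.
have [m [k [m0 hm1 hm]]] := commuting_common_power ng h1 cgh.
have hmn : h ^+ m ^+ n = 1 by rewrite expgnAC hn expg1n.
have gkn : g ^+ (k * n) = 1.
  move: hmn; case: hm => ->; rewrite ?expVgn -expgnA // => /eqP.
  by rewrite invg_eq1 => /eqP.
case: (posnP (k * n)) => [/eqP|/(expg_hyperbolic_neq1 ng)//].
rewrite muln_eq0 (gtn_eqF n0) orbF => /eqP k0; apply: hm1.
by case: hm => ->; rewrite k0 // invg1.
Qed.

(** The kernel of the projection of [G] to the product of its factors, stated
    through the actions of [G] on itself via the two projections. *)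
Definition cartesian : set G :=
  [set g | forall s phi, is_action setT phi ->
    (forall t x, F t x -> phi x = if t == s then *%g x else id) ->
    phi g = id].

Lemma action_kernel_normal X (phi : G -> X -> X) :
  is_action setT phi -> is_normal_subgroup [set g | phi g = id].
Proof.
move=> [p1 pM]; split; first split=> [|x y /= ex ey|x /= ex].
- exact/funext.
- by apply/funext => z; rewrite pM // ex ey.
- by apply/funext => z; rewrite -{1}[z]/(id z) -ex -pM // mulVg p1.
move=> x g /= ex; apply/funext => z.
by rewrite conjgE !pM // ex -pM // mulVg p1.
Qed.

Lemma cartesian_normal : is_normal_subgroup cartesian.
Proof.
split; first split=> [|x y cx cy|x cx] s phi pP pF.
- by have [[]] := action_kernel_normal pP.
- by have [[_ + _] _] := action_kernel_normal pP; apply; [apply: cx pF|apply: cy pF].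
- by have [[_ _ +] _] := action_kernel_normal pP; apply; apply: cx pF.
move=> x g cx s phi pP pF.
by have [_ +] := action_kernel_normal pP; apply; apply: cx pF.
Qed.

Lemma cartesian_hyperbolic g : cartesian g -> g <> 1 -> ~ elliptic g.
Proof.
move=> cg g1 [s [h Fgh]]; apply: g1; apply/eqP; rewrite -(conjg_eq1 _ h); apply/eqP.
have [phi [pP pF]] := factor_projection_act s.
have [_ /(_ g h cg)/(_ s phi pP pF)] := cartesian_normal.
by rewrite (pF _ _ Fgh) eqxx => /(congr1 (fun f => f 1)); rewrite mulg1.
Qed.

Lemma commg_cartesian s x y : F s x -> F (~~ s) y -> cartesian [~ x, y].
Proof.
move=> Fx Fy t phi pP pF; have [p1 pM] := pP.
apply/funext => z; rewrite /commg conjgE !pM //.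
rewrite (pF _ _ (FV Fx)) (pF _ _ (FV Fy)) (pF _ _ Fx) (pF _ _ Fy).
by clear; case: s; case: t => //=; rewrite mulKg.
Qed.

Lemma commg_factors_neq1 s x y : F s x -> F (~~ s) y -> x <> 1 -> y <> 1 ->
  [~ x, y] <> 1.
Proof.
move=> Fx Fy /eqP x1 /eqP y1.
have sx := side_letter Fx x1; have sy := side_letter Fy y1.
have rw : reduced [:: x^-1; y^-1; x; y].
  rewrite !reduced_cons !letterV ?(letterP Fx) ?(letterP Fy) //= !sideV sx sy.
  by case: s {Fx Fy sx sy}.
have <- : prodw [:: x^-1; y^-1; x; y] = [~ x, y].
  by rewrite !prodw_cons prodw_nil mulg1.
by rewrite -prodw_nil => /prodw_inj - /(_ rw erefl).
Qed.

(** * Subgroups of finite index *)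

Lemma expg_subgroup (K : set G) g n : is_subgroup K -> K g -> K (g ^+ n).
Proof.
by case=> K1 KM _ Kg; elim: n => // n IH; rewrite expgS; apply: KM.
Qed.

Lemma nontrivial_subgroup (K : set G) :
  is_subgroup K -> K <> [set 1] -> exists2 g, K g & g <> 1.
Proof.
move=> [K1 _ _] Kn; apply: contrapT => no; apply: Kn.
apply/seteqP; split=> [g Kg|_ ->//]; apply: contrapT => g1.
by apply: no; exists g.
Qed.

Lemma left_coset_eq (H : set G) g h :
  is_subgroup H -> left_coset H g = left_coset H h -> H (g^-1 * h).
Proof.
move=> [H1 _ _] e; have : left_coset H h h by exists 1 => //; rewrite mulg1.
by rewrite -e => -[k Hk <-]; rewrite mulKg.
Qed.

Lemma eq_left_coset (H : set G) g h :
  is_subgroup H -> H (g^-1 * h) -> left_coset H g = left_coset H h.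
Proof.
move=> [_ HM HV] Hgh; apply/seteqP; split=> _ [k Hk <-].
  exists (h^-1 * g * k); last by rewrite mulgA mulVKg.
  by apply: HM => //; rewrite -[g]invgK -invgM; apply: HV.
by exists (g^-1 * h * k); [apply: HM|rewrite mulgA mulVKg].
Qed.

Lemma coset_pigeonhole (H : set G) (D : set (set G)) (f : nat -> G) :
  is_subgroup H -> finite_set D -> (forall n, D (left_coset H (f n))) ->
  exists i j, i < j /\ H ((f i)^-1 * f j).
Proof.
move=> HH finD fD; apply: contrapT => no; apply: infinite_nat.
pose c n := left_coset H (f n).
have -> : [set: nat] = c @^-1` D by apply/seteqP; split=> // n _; exact: fD.
apply: finite_preimage finD => i j _ _ e.
case: (ltngtP i j) => // ij; case: no.
  by exists i, j; split=> //; exact: left_coset_eq.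
by exists j, i; split=> //; exact: left_coset_eq (esym e).
Qed.

(** If the intersection were trivial, then elements of [N] in one coset of [H]
    would be equal.  Applied to the conjugates of an element [n] by powers of a
    commutator [d] of two letters, this makes [n] commute with a power of [d],
    hence of infinite order; applied to the powers of [n], it contradicts that. *)
Lemma finite_index_meets_normal (H N : set G) x y :
  F true x -> F false y -> x <> 1 -> y <> 1 ->
  is_subgroup H -> has_finite_index H ->
  is_normal_subgroup N -> N <> [set 1] -> H `&` N <> [set 1].
Proof.
move=> Fx Fy x1 y1 HH finH [NG NJ] /(nontrivial_subgroup NG)[n Nn n1] HN.
have [_ NM NV] := NG.
have HN1 g : H g -> N g -> g = 1.
  by move=> Hg Ng; have : [set 1] g by rewrite -HN.
pose d := [~ x, y].
have ellV k : 0 < k -> ~ elliptic (d ^+ k).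
  move=> k0; have cd := commg_cartesian Fx Fy.
  have nd := cartesian_hyperbolic cd (commg_factors_neq1 Fx Fy x1 y1).
  apply: cartesian_hyperbolic; last exact: expg_hyperbolic_neq1.
  by apply: (expg_subgroup (K := cartesian)) => //; case: cartesian_normal.
have cosets (f : nat -> G) k : range (left_coset H) (left_coset H (f k)) by exists (f k).
have [i [j [ij Hij]]] := coset_pigeonhole HH finH (cosets (fun k => n ^ (d ^+ k))).
have cdn : commute (d ^+ (j - i)) n.
  apply/commute_sym/commgP; apply/conjg_fixP; apply: (@conjg_inj _ (d ^+ i)).
  rewrite -conjgM -expgnDr subnK ?(ltnW ij) //; apply/esym.
  apply: (mulgI (n ^ d ^+ i)^-1); rewrite mulVg; apply/esym/HN1 => //.
  by apply: NM; [apply: NV|]; apply: NJ.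
have dij : ~ elliptic (d ^+ (j - i)) by apply: ellV; rewrite subn_gt0.
have [k [l [kl Hkl]]] := coset_pigeonhole HH finH (cosets (fun k => n ^+ k)).
have lk0 : 0 < l - k by rewrite subn_gt0.
apply: (commute_hyperbolic_expg_neq1 dij n1 cdn lk0).
apply: HN1; last exact: (expg_subgroup (K := N)).
by move: Hkl; rewrite -(subnKC (ltnW kl)) expgnDr mulKg addKn.
Qed.

(** * The core of the coset graph of a finitely generated subgroup *)

Section Core.
Variable H : set G.
Hypothesis HH : is_subgroup H.

Let H1 : H 1. Proof. by case: HH. Qed.
Let HM g h : H g -> H h -> H (g * h). Proof. by case: HH => _ + _; apply. Qed.
Let HV g : H g -> H g^-1. Proof. by case: HH => _ _; apply. Qed.

Definition cover (L : seq G) : set G :=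
  [set g | exists2 c, c \in L & H (c^-1 * g)].

Lemma cover_mulr L g h : cover L g -> H h -> cover L (g * h).
Proof. by move=> [c cL Hcg] Hh; exists c; rewrite // mulgA; apply: HM. Qed.

Lemma cover_mulrE L g h : H h -> cover L (g * h) -> cover L g.
Proof. by move=> Hh /cover_mulr/(_ (HV Hh)); rewrite mulgK. Qed.

Lemma cover_catl L1 L2 g : cover L1 g -> cover (L1 ++ L2) g.
Proof. by move=> [c cL Hc]; exists c; rewrite // mem_cat cL. Qed.

Lemma cover_catr L1 L2 g : cover L2 g -> cover (L1 ++ L2) g.
Proof. by move=> [c cL Hc]; exists c; rewrite // mem_cat cL orbT. Qed.

Lemma cover_mull L x g : cover L (x * g) -> cover [seq x^-1 * c | c <- L] g.
Proof.
move=> [c cL Hc]; exists (x^-1 * c); first exact: map_f.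
by rewrite invgM invgK -mulgA.
Qed.

Lemma cover_setT_finite_index L : (forall g, cover L g) -> has_finite_index H.
Proof.
move=> allL; apply: (sub_finite_set (B := left_coset H @` [set` L])).
  move=> _ [g _ <-]; have [c cL Hcg] := allL g.
  by exists c => //; exact: eq_left_coset.
by apply: finite_image; exact: finite_seq.
Qed.

(** A word, read from its last letter, traces a path from the base point of the
    graph of cosets [g H]; the vertices of the path are the products of the
    suffixes. *)
Fixpoint suffixes_in (C : set G) w : Prop :=
  C (prodw w) /\ if w is _ :: w' then suffixes_in C w' else True.

Lemma suffixes_in_sub (C D : set G) w :
  C `<=` D -> suffixes_in C w -> suffixes_in D w.
Proof. by move=> CD; elim: w => [|x w IH] /= [/CD ? ?]; split=> //; exact: IH. Qed.

Lemma suffixes_in_prodw C w : suffixes_in C w -> C (prodw w).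
Proof. by case: w => [|x w] []. Qed.

Lemma suffixes_in_cat C u v :
  suffixes_in [set g | C (g * prodw v)] u -> suffixes_in C v ->
  suffixes_in C (u ++ v).
Proof.
by elim: u => [|x u IH] //= [Cu su] sv; split; [rewrite -cat_cons prodw_cat|exact: IH].
Qed.

Lemma suffixes_in_catr C u v : suffixes_in C (u ++ v) -> suffixes_in C v.
Proof. by elim: u => //= x u IH [_ /IH]. Qed.

Lemma suffixes_in_winv C w :
  suffixes_in C w -> suffixes_in [set g | C (g * prodw w)] (winv w).
Proof.
elim: w => [|x w IH] /=; first by rewrite prodw_nil mul1g => -[].
move=> [Cxw sw]; rewrite -cat1s winv_cat; apply: suffixes_in_cat.
  apply: suffixes_in_sub (IH sw) => g /=.
  by rewrite /winv /= prodw1 prodw_cons -mulgA mulKg.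
rewrite /winv /= prodw_nil prodw1 mul1g prodw_cons mulKg; do !split=> //.
  exact: suffixes_in_prodw.
by rewrite -prodw_cons.
Qed.

Definition suffix_products w := [seq prodw (drop n w) | n <- iota 0 (size w).+1].

Lemma suffixes_inP C w :
  (forall n, C (prodw (drop n w))) -> suffixes_in C w.
Proof.
elim: w => [|x w IH] /= dC; first by have := dC 0.
by split; [exact: (dC 0)|apply: IH => n; exact: (dC n.+1)].
Qed.

Lemma mem_suffix_products n w : prodw (drop n w) \in suffix_products w.
Proof.
apply/mapP; case: (leqP n (size w)) => nw; first by exists n; rewrite ?mem_iota.
by exists (size w); rewrite ?mem_iota ?ltnSn // drop_size drop_oversize // ltnW.
Qed.

(** Merging or cancelling two letters drops the vertex between them. *)
Lemma suffixes_in_reduce C w :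
  all letter w -> suffixes_in C w -> suffixes_in C (nf (prodw w)).
Proof.
elim: w => [|x w IH] /=; first by move=> _ [C1 _]; rewrite prodwK.
case/andP=> /letter_side Fx lw [Cxw /(IH lw)].
have rw := reduced_nf (prodw w); move: (nf _) rw (nfK (prodw w)) => v rv ev sv.
rewrite prodw_cons -ev -(prodw_push (side x)) // prodwK; last exact: reduced_push.
have stl : suffixes_in C (tl (side x) v).
  by case: v sv {rv ev} => //= y v; case: ifP => // _ [].
rewrite /push rv /glue; case: eqP => // _; split=> //.
rewrite prodw_cons -mulgA -prodw_glue glue_hd_tl //.
by rewrite ev -prodw_cons.
Qed.

(** The core consists of the vertices visited by the reduced words of the
    generators.  Products and inverses of words whose paths stay in the core
    are again such words, and reducing a word only removes vertices from its
    path. *)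
Lemma finite_core : finitely_generated H -> exists L, [/\ cover L 1,
  forall h, H h -> suffixes_in (cover L) (nf h)
  & forall g, cover L g -> exists w h,
      [/\ reduced w, suffixes_in (cover L) w, H h & prodw w = g * h]].
Proof.
move=> [S [/finite_seqP[gens genS] HS]].
pose L := 1 :: flatten [seq suffix_products (nf g) | g <- gens].
have subL c : c \in L -> cover L c by exists c => //; rewrite mulVg.
have L1 : cover L 1 by apply: subL; rewrite mem_head.
have gensL g n : g \in gens -> prodw (drop n (nf g)) \in L.
  move=> gg; rewrite inE; apply/orP; right; apply/flattenP.
  by exists (suffix_products (nf g)); [exact: map_f|exact: mem_suffix_products].
exists L; split=> //.
- pose K : set G := [set h | H h /\
    exists w, [/\ all letter w, prodw w = h & suffixes_in (cover L) w]].
  suff KH h : H h -> K h.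
    by move=> h /KH[_ [w [lw <- sw]]]; apply: suffixes_in_reduce.
  rewrite {1}HS; apply; split; last first.
    rewrite genS => g /= gg; split; first by rewrite HS => M [_]; apply; rewrite genS.
    exists (nf g); rewrite nfK; split=> //; first exact/reduced_letters/reduced_nf.
    by apply: suffixes_inP => n; apply/subL/gensL.
  split.
  + by split=> //; exists [::]; split=> //=; rewrite prodw_nil.
  + move=> g k [Hg [u [lu eu su]]] [Hk [v [lv ev sv]]]; split; first exact: HM.
    exists (u ++ v); rewrite all_cat lu lv prodw_cat eu ev; split=> //.
    apply: suffixes_in_cat => //; rewrite ev; apply: suffixes_in_sub su => l Cl.
    exact: cover_mulr.
  + move=> g [Hg [u [lu eu su]]]; split; first exact: HV.
    exists (winv u); rewrite all_letter_winv // prodw_winv eu; split=> //.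
    apply: suffixes_in_sub (suffixes_in_winv su) => k /=; rewrite eu.
    exact: cover_mulrE.
move=> g [c cL Hcg].
suff [w [rw sw ew]] : exists w, [/\ reduced w, suffixes_in (cover L) w & prodw w = c].
  exists w, (g^-1 * c); split=> //; last by rewrite mulVKg.
  by rewrite -[c]invgK -invgM; apply: HV.
move: cL; rewrite inE => /orP[/eqP ->|/flattenP[_ /mapP[k gk ->]]].
  by exists [::]; split=> //=; rewrite prodw_nil.
case/mapP => n _ ->; exists (drop n (nf k)); split=> //.
  by apply: (reduced_catr (u := take n (nf k))); rewrite cat_take_drop; exact: reduced_nf.
apply: (suffixes_in_catr (u := take n (nf k))); rewrite cat_take_drop.
by apply: suffixes_inP => m; apply/subL/gensL.
Qed.

(** * Cutting the coset graph down to its core *)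

Section Surgery.
Variable L : seq G.
Hypothesis L1 : cover L 1.
Hypothesis coreH : forall h, H h -> suffixes_in (cover L) (nf h).
Hypothesis coreP : forall g, cover L g -> exists w h,
  [/\ reduced w, suffixes_in (cover L) w, H h & prodw w = g * h].

Definition star s : set G := [set g | exists2 x, F s x & cover L (x * g)].

Lemma cover_star s : cover L `<=` star s.
Proof. by move=> g Cg; exists 1; rewrite ?mul1g. Qed.

Lemma star_mull s x g : F s x -> star s g -> star s (x * g).
Proof.
move=> Fx [y Fy Cy]; exists (y * x^-1); first by apply: FM => //; apply: FV.
by rewrite mulgA mulgVK.
Qed.

Lemma star_mullE s x g : F s x -> star s (x * g) = star s g.
Proof.
move=> Fx; apply/propext; split; last exact: star_mull.
by rewrite -{2}[g](mulKg x); apply: star_mull; apply: FV.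
Qed.

Lemma star_mulrE s g h : H h -> star s (g * h) = star s g.
Proof.
move=> Hh; apply/propext; split=> -[x Fx Cx]; exists x => //.
  by apply: cover_mulrE Hh _; rewrite -mulgA.
by rewrite mulgA; apply: cover_mulr.
Qed.

(** Follow a path through the core to the orbit of [g] under [F s], then a letter
    of [F s].  If that letter cancelled the last one of the path, then [g] would
    be in the core; so the reduced path ends with a letter of [F s]. *)
Lemma star_path s g : star s g -> ~ cover L g -> exists x v h,
  [/\ reduced (x :: v), side x = s, H h & prodw (x :: v) = g * h].
Proof.
move=> [y Fy Cyg] nCg; have [w [h [rw sw Hh ew]]] := coreP Cyg.
have Fy' := FV Fy.
have rp := reduced_push Fy' rw; have := prodw_push s y^-1 rw.
rewrite ew -mulgA mulKg => ep.
have stl : suffixes_in (cover L) (tl s w).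
  by case: w sw {rw ew rp ep} => //= z w; case: ifP => // _ [].
move: rp ep; rewrite /push rw /glue; case: eqP => [_ _ ep|/eqP z1 rz ez].
  by case: nCg; apply: cover_mulrE Hh _; rewrite -ep; exact: suffixes_in_prodw.
exists (y^-1 * hd s w), (tl s w), h; split=> //.
by apply: side_letter z1; apply: FM => //; exact: hd_factor.
Qed.

(** A vertex outside the core that lies on the stars of both kinds closes a
    reduced loop leaving the core, and the reduced word of an element of [H]
    does not leave the core. *)
Lemma star_both g : star true g -> star false g -> cover L g.
Proof.
move=> /star_path sA /star_path sB; apply: contrapT => nCg.
have [x [u [h [ru sx Hh eu]]]] := sA nCg.
have [y [v [k [rv sy Hk ev]]]] := sB nCg.
have rw : reduced (winv (x :: u) ++ (y :: v)).
  rewrite -cat1s winv_cat [winv [:: x]]/winv /= cats1; apply: reduced_cat => //.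
    by have := reduced_winv ru; rewrite -cat1s winv_cat cats1.
  by rewrite /= sideV sx sy.
have ew : prodw (winv (x :: u) ++ (y :: v)) = h^-1 * k.
  by rewrite prodw_cat prodw_winv eu ev invgM -mulgA mulKg.
have := coreH (HM (HV Hh) Hk); rewrite -ew prodwK // => /suffixes_in_catr.
by move=> /suffixes_in_prodw; rewrite ev => /(cover_mulrE Hk).
Qed.

(** The new action of [G] on the set [G]: a letter of the factor [s] multiplies
    on the left over the star of kind [s] and does nothing elsewhere.  It
    commutes with right multiplication by [H]. *)
Lemma core_action_exists : exists phi : G -> G -> G, is_action setT phi /\
  forall s x, F s x -> forall g, phi x g = if `[< star s g >] then x * g else g.
Proof.
have [|phi [phiP phiF]] := factor_act HF
    (act := fun s x g => if `[< star s g >] then x * g else g).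
  move=> s; split=> [g|x y Fx Fy g]; first by rewrite mul1g if_same.
  case: ifP => [/asboolP sg|->//].
  by rewrite asboolT ?star_mullE // mulgA.
by exists phi; split=> // s x Fx g; rewrite (phiF _ _ Fx).
Qed.

Variable phi : G -> G -> G.
Hypothesis phiP : is_action setT phi.
Hypothesis phiF : forall s x, F s x ->
  forall g, phi x g = if `[< star s g >] then x * g else g.

Let phi1 z : phi 1 z = z. Proof. by case: phiP. Qed.
Let phiM g h z : phi (g * h) z = phi g (phi h z).
Proof. by case: phiP => _; apply. Qed.
Let phiK g : cancel (phi g) (phi g^-1).
Proof. by move=> z; rewrite -phiM mulVg phi1. Qed.

Lemma core_act_star s x z : F s x -> star s z -> phi x z = x * z.
Proof. by move=> Fx sz; rewrite (phiF Fx) asboolT. Qed.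

Lemma core_act_off s x z : F s x -> ~ star s z -> phi x z = z.
Proof. by move=> Fx sz; rewrite (phiF Fx) asboolF. Qed.

Lemma core_act_mulr g z h : H h -> phi g (z * h) = phi g z * h.
Proof.
move=> Hh; elim/(factor_ind HF): g z => [|s x g Fx IH] z; first by rewrite !phi1.
by rewrite !phiM IH !(phiF Fx) star_mulrE //; case: ifP; rewrite ?mulgA.
Qed.

(** Along a path in the core the new action agrees with multiplication, since
    the core lies on both stars. *)
Lemma core_act_path w :
  all letter w -> suffixes_in (cover L) w -> phi (prodw w) 1 = prodw w.
Proof.
elim: w => [|x w IH] /=; first by rewrite prodw_nil phi1.
move=> /andP[/letter_side Fx lw] [_ sw]; rewrite prodw_cons phiM IH //.
apply: (core_act_star Fx); apply: cover_star; exact: suffixes_in_prodw sw.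
Qed.

Lemma core_act_subgroup h : H h -> phi h 1 = h.
Proof.
move=> Hh; rewrite -{1 2}[h]nfK; apply: core_act_path; last exact: coreH.
exact/reduced_letters/reduced_nf.
Qed.

Lemma core_kernel_meets_trivially : H `&` [set g | phi g = id] = [set 1].
Proof.
apply/seteqP; split=> [h [Hh /= eh]|_ ->]; last first.
  by split=> //=; apply/funext.
by rewrite /= -(core_act_subgroup Hh) eh.
Qed.

Lemma core_act_base s z : star s z -> exists g, H (phi g z).
Proof.
move=> [x Fx Cxz]; have [w [h [rw sw Hh ew]]] := coreP Cxz.
exists ((prodw w)^-1 * x); rewrite phiM (core_act_star Fx); last by exists x.
rewrite -[x * z](mulgK h) -ew core_act_mulr; last exact: HV.
rewrite -{2}[prodw w](core_act_path (reduced_letters rw) sw) phiK mul1g.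
exact: HV.
Qed.

(** Every vertex on a star is connected to the base point by the new action. *)
Lemma core_act_transitive s t y z : star s y -> star t z ->
  exists g h, H h /\ phi g z = y * h.
Proof.
move=> /core_act_base[g Hg] /core_act_base[k Hk].
exists (g^-1 * k), ((phi g y)^-1 * phi k z); split; first exact: HM (HV Hg) Hk.
rewrite phiM -{1}[phi k z](mulVKg (phi g y)) core_act_mulr ?phiK //.
exact: HM (HV Hg) Hk.
Qed.

(** If the core is not the whole graph then some edge leaves it, and by
    [star_both] its end lies on a star of one kind only. *)
Lemma core_boundary : ~ (forall g, cover L g) ->
  exists s y, star s y /\ ~ star (~~ s) y.
Proof.
move=> nall; apply: contrapT => no; apply: nall.
apply: (factor_ind HF) => // s x g Fx Cg; apply: contrapT => nC.
have sxg : star s (x * g) by rewrite star_mullE //; exact: cover_star.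
apply: no; exists s, (x * g); split=> // sxg'; apply: nC.
by apply: star_both; case: s sxg sxg' {Fx}.
Qed.

Definition fixes z : set G := [set g | phi g z = z].
Definition fixes_coset z : set G := [set g | H (z^-1 * phi g z)].
Definition pure : set G := [set g | forall z, fixes_coset z g].

Lemma fixes_subgroup z : is_subgroup (fixes z).
Proof.
split=> [|g h gz hz|g gz]; rewrite /fixes /= ?phi1 //.
  by rewrite phiM hz.
by rewrite -{1}gz phiK.
Qed.

Lemma fixes_mulr z g h : H h -> fixes z g -> fixes (z * h) g.
Proof. by move=> Hh gz; rewrite /fixes /= core_act_mulr // gz. Qed.

Lemma fixes_cosetP z g : fixes_coset z g -> exists2 h, H h & phi g z = z * h.
Proof. by move=> Hg; exists (z^-1 * phi g z); rewrite // mulVKg. Qed.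

Lemma fixes_cosetI z g h : H h -> phi g z = z * h -> fixes_coset z g.
Proof. by move=> Hh e; rewrite /fixes_coset /= e mulKg. Qed.

Lemma fixes_coset_subgroup z : is_subgroup (fixes_coset z).
Proof.
split=> [|g h /fixes_cosetP[a Ha ea] /fixes_cosetP[b Hb eb]|g /fixes_cosetP[a Ha ea]].
- by apply: fixes_cosetI H1 _; rewrite phi1 mulg1.
- by apply: fixes_cosetI (HM Ha Hb) _; rewrite phiM eb core_act_mulr // ea mulgA.
- apply: fixes_cosetI (HV Ha) _; apply: (canLR (phiK g)) => //.
  by rewrite core_act_mulr ?ea ?mulgK //; exact: HV.
Qed.

Lemma fixes_coset_mulr z g h : H h -> fixes_coset z g -> fixes_coset (z * h) g.
Proof.
move=> Hh /fixes_cosetP[a Ha ea]; apply: (fixes_cosetI (h := h^-1 * a * h)).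
  by apply: HM => //; apply: HM => //; exact: HV.
by rewrite core_act_mulr // ea -!mulgA mulVKg.
Qed.

Lemma pure_normal : is_normal_subgroup pure.
Proof.
split; first split=> [|g h pg ph|g pg] z.
- by have [] := fixes_coset_subgroup z.
- by have [_ + _] := fixes_coset_subgroup z; apply.
- by have [_ _ +] := fixes_coset_subgroup z; apply.
move=> g k pg z; have [h Hh e] := fixes_cosetP (pg (phi k z)).
by apply: (fixes_cosetI Hh); rewrite conjgE !phiM e core_act_mulr // phiK.
Qed.

Definition finite_support g := exists M, forall z, ~ fixes z g -> cover M z.

Lemma finite_supportX g n : finite_support g -> finite_support (g ^+ n).
Proof.
move=> [M suppg]; exists M => z nz; apply: suppg => gz; apply: nz.
exact: (expg_subgroup (K := fixes z)) (fixes_subgroup z) gz.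
Qed.

(** Outside the core a vertex is moved by one factor at most.  If its image
    under the letter of that factor is outside the core too, then the other
    letter moves neither of them and the commutator fixes the vertex. *)
Lemma commg_finite_support s x y :
  F s x -> F (~~ s) y -> finite_support [~ x, y].
Proof.
move=> Fx Fy; exists (L ++ [seq x^-1 * c | c <- L] ++ [seq y^-1 * c | c <- L]) => z.
have both g : star s g -> star (~~ s) g -> cover L g.
  by move=> sg ng; apply: star_both; move: sg ng; case: (s).
move=> nz; apply: contrapT => nC.
have nCz : ~ cover L z by move=> Cz; apply: nC; exact: cover_catl.
have nCx : ~ cover L (x * z).
  by move=> Cz; apply: nC; apply/cover_catr/cover_catl; exact: cover_mull.
have nCy : ~ cover L (y * z).
  by move=> Cz; apply: nC; apply/cover_catr/cover_catr; exact: cover_mull.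
apply: nz; rewrite /fixes /= /commg conjgE !phiM.
have [sy|sy] := pselect (star (~~ s) z).
  have syz : star (~~ s) (y * z) by rewrite star_mullE.
  have nsx : ~ star s (y * z) by move=> /both/(_ syz).
  rewrite (core_act_star Fy sy) (core_act_off Fx nsx).
  rewrite (core_act_star (FV Fy) syz) mulKg.
  by apply: (core_act_off (FV Fx)) => /both/(_ sy).
rewrite (core_act_off Fy sy).
have [sx|sx] := pselect (star s z); last first.
  by rewrite (core_act_off Fx sx) (core_act_off (FV Fy) sy) (core_act_off (FV Fx) sx).
have sxz : star s (x * z) by rewrite star_mullE.
rewrite (core_act_star Fx sx) (core_act_off (FV Fy)) => [|/(both _ sxz)//].
by rewrite (core_act_star (FV Fx) sxz) mulKg.
Qed.

(** * The kernel of the new action is not trivial *)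

(** The orbit of [c] under the powers of [g] stays in the support of [g], which
    meets finitely many cosets, so it returns to a coset already visited. *)
Lemma coset_power g c : finite_support g ->
  exists n, 0 < n /\ fixes_coset c (g ^+ n).
Proof.
move=> [M suppg].
have [gc|gc] := pselect (fixes c g).
  by exists 1%N; split=> //; rewrite /fixes_coset /= expg1 gc mulVg.
have orbit n : ~ fixes (phi (g ^+ n) c) g.
  rewrite /fixes /= -phiM -expgS expgSr phiM => e; apply: gc.
  by have := congr1 (phi (g ^+ n)^-1) e; rewrite !phiK.
have [i [j [ij Hij]]] : exists i j, i < j /\
    H ((phi (g ^+ i) c)^-1 * phi (g ^+ j) c).
  apply: (@coset_pigeonhole H (left_coset H @` [set` M]) _ HH).
    by apply: finite_image; exact: finite_seq.
  move=> n; have [b bM Hb] := suppg _ (orbit n); exists b => //.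
  exact: eq_left_coset.
exists (j - i)%N; split; first by rewrite subn_gt0.
apply: (fixes_cosetI Hij); rewrite -{2}[c](phiK (g ^+ i)).
by rewrite -core_act_mulr // mulVKg -(subnKC (ltnW ij)) expgnDr phiM phiK addKn.
Qed.

Lemma pure_power g : finite_support g -> exists n, 0 < n /\ pure (g ^+ n).
Proof.
move=> fg; have [M suppg] := fg.
suff [n [n0 nM]] : exists n, 0 < n /\ forall c, c \in M -> fixes_coset c (g ^+ n).
  exists n; split=> // z.
  have [gz|/suppg[c cM Hcz]] := pselect (fixes z g).
    apply: (fixes_cosetI H1); rewrite mulg1.
    exact: (expg_subgroup (K := fixes z)) (fixes_subgroup z) gz.
  by rewrite -[z](mulVKg c); apply: fixes_coset_mulr => //; apply: nM.
elim: M {suppg} => [|c M [n [n0 nM]]]; first by exists 1%N.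
have [m [m0 mc]] := coset_power c fg.
exists (m * n)%N; split; first by rewrite muln_gt0 m0.
have powK z k l : fixes_coset z (g ^+ k) -> fixes_coset z (g ^+ (k * l)).
  rewrite expgnA; apply: (expg_subgroup (K := fixes_coset z)).
  exact: fixes_coset_subgroup.
move=> z; rewrite inE => /orP[/eqP ->|zM]; first exact: powK.
by rewrite mulnC; apply: powK; apply: nM.
Qed.

(** A pure element maps [z] within its coset [z H], over which an element that
    fixes [z] acts trivially. *)
Lemma pure_commg_fixes g h z :
  pure g -> pure h -> fixes z g \/ fixes z h -> fixes z [~ g, h].
Proof.
move=> pg ph; have [f1 fM fV] := fixes_subgroup z; case=> [gz|hz].
  rewrite /commg; apply: fM; first exact: fV.
  have [a Ha ea] := fixes_cosetP (ph z).
  rewrite /fixes conjgE /= !phiM ea.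
  by rewrite [phi g _](fixes_mulr Ha gz) -ea phiK.
have -> : [~ g, h] = (g^-1 * h^-1 * g) * h by rewrite /commg conjgE !mulgA.
apply: fM => //; have [a Ha ea] := fixes_cosetP (pg z).
rewrite /fixes /= -mulgA !phiM ea.
by rewrite [phi h^-1 _](fixes_mulr Ha (fV _ hz)) -ea phiK.
Qed.

(** Pure elements act over each single coset, so their commutator acts
    trivially over a coset where one of them does.  If the commutator is
    trivial, the two elements have a common nontrivial power. *)
Lemma pure_meet g h :
  cartesian g -> cartesian h -> pure g -> pure h -> g <> 1 -> h <> 1 ->
  exists k, [/\ cartesian k, pure k, k <> 1 &
    forall z, fixes z g \/ fixes z h -> fixes z k].
Proof.
move=> cg ch pg ph g1 h1.
have [[_ cM cV] cJ] := cartesian_normal; have [[_ pM pV] pJ] := pure_normal.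
have [e|ne] := eqVneq [~ g, h] 1; last first.
  exists [~ g, h]; split; last by move=> z; exact: pure_commg_fixes.
  - by rewrite /commg; apply: cM; [apply: cV|apply: cJ].
  - by rewrite /commg; apply: pM; [apply: pV|apply: pJ].
  - exact/eqP.
have cgh : commute g h by apply/commgP/eqP.
have [m [n [m0 hm1 hm]]] :=
  commuting_common_power (cartesian_hyperbolic cg g1) h1 cgh.
exists (h ^+ m); split=> //.
- by apply: (expg_subgroup (K := cartesian)) => //; case: cartesian_normal.
- by apply: (expg_subgroup (K := pure)) => //; case: pure_normal.
move=> z; have fz := fixes_subgroup z; case=> [gz|hz]; last first.
  exact: (expg_subgroup (K := fixes z)).
have gnz := expg_subgroup (K := fixes z) n fz gz.
by case: hm => -> //; case: fz => _ _; apply.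
Qed.

(** Over a vertex [y] off the stars of kind [~~ s] the letters of the factor
    [~~ s] act trivially, so the commutator of such a letter with a pure
    element does too. *)
Lemma pure_fixing_boundary s y a b :
  F s a -> F (~~ s) b -> a <> 1 -> b <> 1 -> ~ star (~~ s) y ->
  exists v : G, [/\ cartesian v, pure v, v <> 1, finite_support v & fixes y v].
Proof.
move=> Fa Fb a1 b1 sy.
have [[_ cM cV] cJ] := cartesian_normal; have [[_ pM pV] pJ] := pure_normal.
have cd := commg_cartesian Fa Fb; have fd := commg_finite_support Fa Fb.
have hd := cartesian_hyperbolic cd (commg_factors_neq1 Fa Fb a1 b1).
have [n [n0 pp]] := pure_power fd; move: pp.
have : finite_support ([~ a, b] ^+ n) by exact: finite_supportX.
have : cartesian ([~ a, b] ^+ n).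
  by apply: (expg_subgroup (K := cartesian)) => //; case: cartesian_normal.
move: (expg_hyperbolic_neq1 hd n0); move: (_ ^+ n) => p p1 cp [M suppp] pp.
have yb : fixes y b by exact: core_act_off Fb sy.
exists [~ p, b]; rewrite /commg; split.
- by apply: cM; [apply: cV|apply: cJ].
- by apply: pM; [apply: pV|apply: pJ].
- (* A common power of [b] and [p] lies in a factor and in [cartesian]. *)
  move=> e; have cpb : commute p b by apply/commgP/eqP.
  have hp := cartesian_hyperbolic cp p1.
  have [m [k [m0 bm1 bm]]] := commuting_common_power hp b1 cpb.
  have cpk : cartesian (p ^+ k).
    by apply: (expg_subgroup (K := cartesian)) => //; case: cartesian_normal.
  have cbm : cartesian (b ^+ m) by case: bm => -> //; apply: cV.
  apply: (cartesian_hyperbolic cbm bm1); exists (~~ s), 1; rewrite conjg1.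
  exact: expg_subgroup (factor_subgroup HF _) Fb.
- exists (M ++ M ++ [seq b^-1 * c | c <- M]) => z; apply: contra_notP => nC.
  have [_ fM fV] := fixes_subgroup z.
  have pz : fixes z p.
    by apply: contrapT => /suppp Mz; apply: nC; exact: cover_catl.
  apply: fM; first exact: fV.
  have pbz : fixes (phi b z) p.
    apply: contrapT => /suppp; rewrite (phiF Fb); case: ifP => _ Mz; apply: nC.
      by apply/cover_catr/cover_catr; exact: cover_mull.
    exact: cover_catl.
  by rewrite /fixes /= conjgE !phiM pbz phiK.
- have [h Hh e] := fixes_cosetP (pp y).
  have [_ _ fV] := fixes_subgroup y.
  rewrite -/([~ p, b]).
  have -> : [~ p, b] = p^-1 * b^-1 * p * b by rewrite /commg conjgE !mulgA.
  rewrite /fixes /= !phiM yb e [phi b^-1 _](fixes_mulr Hh (fV _ yb)) -e phiK //.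
Qed.

(** Starting from [v] as above, the action being transitive on the vertices that
    matter, conjugates of [v] act trivially over each of the finitely many
    vertices over which [v] does not; meeting all of them leaves an element
    that acts trivially everywhere. *)
Lemma core_kernel_nontrivial x y :
  F true x -> F false y -> x <> 1 -> y <> 1 ->
  ~ (forall g, cover L g) -> [set g | phi g = id] <> [set 1].
Proof.
move=> Fx Fy x1 y1 /core_boundary[s [e [se nse]]].
have [v [cv pv v1 [M suppv] ve]] : exists v : G,
    [/\ cartesian v, pure v, v <> 1, finite_support v & fixes e v].
  case: s {se} nse => nse.
    exact: (pure_fixing_boundary (s := true) Fx Fy x1 y1 nse).
  exact: (pure_fixing_boundary (s := false) Fy Fx y1 x1 nse).
have [_ cJ] := cartesian_normal; have [_ pJ] := pure_normal.
have [u [cu pu u1 uv uM]] : exists u : G, [/\ cartesian u, pure u, u <> 1,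
    forall z, fixes z v -> fixes z u & forall z, z \in M -> fixes z u].
  elim: (M) => [|z M' [u [cu pu u1 uv uM]]]; first by exists v.
  have [[t tz]|nz] := pselect (exists t, star t z); last first.
    exists u; split=> // z'; rewrite inE => /orP[/eqP ->|/uM//].
    apply: uv; rewrite /fixes /=.
    elim/(factor_ind HF): v {cv pv v1 suppv ve} => // t g h Fg IH.
    by rewrite phiM IH (core_act_off Fg) // => tz; apply: nz; exists t.
  have [g [h [Hh eg]]] := core_act_transitive se tz.
  have vgz : fixes z (v ^ g).
    rewrite /fixes /= conjgE !phiM eg [phi v _](fixes_mulr Hh ve) -eg phiK //.
  have vg1 : v ^ g <> 1 by move/eqP; rewrite conjg_eq1 => /eqP.
  have [k [ck pk k1 kf]] := pure_meet cu (cJ _ g cv) pu (pJ _ g pv) u1 vg1.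
  exists k; split=> // [z' /uv|z']; first by move=> uz'; apply: kf; left.
  by rewrite inE => /orP[/eqP ->|/uM uz']; apply: kf; [right|left].
suff u_id : phi u = id by move=> e1; have : [set 1] u by rewrite -e1.
apply/funext => z; have [/uv//|/suppv[c cM Hcz]] := pselect (fixes z v).
by rewrite -[z](mulVKg c); apply: fixes_mulr => //; exact: uM.
Qed.
End Surgery.

Lemma infinite_index_avoids_normal x y :
  F true x -> F false y -> x <> 1 -> y <> 1 ->
  finitely_generated H -> ~ has_finite_index H ->
  exists N : set G, [/\ is_normal_subgroup N, N <> [set 1] & H `&` N = [set 1]].
Proof.
move=> Fx Fy x1 y1 fgH infH; have [L [L1 coreH coreP]] := finite_core fgH.
have [phi [phiP phiF]] := core_action_exists L.
exists [set g | phi g = id]; split.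
- exact: action_kernel_normal.
- apply: (core_kernel_nontrivial L1 coreH coreP phiP phiF Fx Fy x1 y1).
  by move=> allL; apply: infH; exact: cover_setT_finite_index allL.
- exact: core_kernel_meets_trivially phiP phiF.
Qed.
End Core.
End FreeProduct.

Theorem theorem2 (A B G : groupType)
    (iA : UMagmaMorphism.type A G) (iB : UMagmaMorphism.type B G)
    (hG : is_free_product iA iB)
    (hA : nontrivial_group A) (hB : nontrivial_group B)
    (H : set G) (hH : is_subgroup H) (hfg : finitely_generated H) :
  has_finite_index H <->
  (forall N : set G, is_normal_subgroup N -> N <> [set 1] ->
     H `&` N <> [set 1]).
Proof.
have HF := free_product_internal hG.
have [x Fx x1] := factor_nontrivial hG true hA hB.
have [y Fy y1] := factor_nontrivial hG false hA hB.
split=> [finH N|meets].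
  exact: (finite_index_meets_normal HF Fx Fy x1 y1 hH finH).
apply: contrapT => infH.
have [N [NG N1 HN]] := infinite_index_avoids_normal HF hH Fx Fy x1 y1 hfg infH.
exact: meets NG N1 HN.
Qed.
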